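(* Let $n\ge 1$ and let $W=w_1w_2\cdots w_{|W|}$ (each $w_l$ a letter) be a non-empty word over $A=\{a_1,\dots,a_n\}$ with content $c(W)$ (the set of letters occurring in $W$). Assume there is an integer $1\le r\le n$ such that neither $a_{r+1}$ nor $a_{r+2}$ (indices modulo $n$) belongs to $c(W)$. Place the positions $1,\dots,n$ clockwise on a circle, and represent $W$ by disjoint segments (clockwise arcs of consecutive positions, possibly wrapping past $n$ to $1$, of length less than the full cycle) $S_k=[i_k,j_k]$, $1\le k\le m$, listed in clockwise order and not completing the cycle, such that: (1) $a_{i_k},a_{j_k}\in c(W)$ for all $k$; (2) $a_{i_k-2},a_{i_k-1},a_{j_k+1},a_{j_k+2}\notin c(W)$ for all $k$; (3) there is no position $l$ in any segment with $a_l,a_{l+1}\notin c(W)$; (4) if the position $l$ lies between two consecutive segments, then $a_l\notin c(W)$. For each $k$, with $j_k-i_k$ measured clockwise, define the word $W_k$ as follows: - if $i_k=j_k$, then $W_k=a_{i_k}$; - if $j_k-i_k=1$ and there are $l'<l$ with $w_{l'}=a_{i_k+1}$ and $w_l=a_{i_k}$, then $W_k=a_{i_k+1}a_{i_k}$; if $j_k-i_k=1$ and there are no such $l',l$, then $W_k=a_{i_k}a_{i_k+1}$; - if $j_k-i_k\ge 2$ is even, then $W_k=a_{i_k}a_{i_k+2}a_{i_k+4}\cdots a_{j_k}$; - if $j_k-i_k\ge 2$ is odd, then $W_k=a_{i_k}a_{i_k+1}a_{i_k+3}a_{i_k+5}\cdots a_{j_k}$. Then $W_1W_2\cdots W_m$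 is the canonical form of $W$. That is, $W=W_1W_2\cdots W_m$ in the Layered Catalan monoid $LC_n$, and if two non-empty words both satisfying the assumption on $W$ are equal in $LC_n$, then the words $W_1,\dots,W_m$ obtained from them are the same up to the order in which the segments are listed.
   Context: Layered Catalan monoid: for $n\ge 1$, $LC_n$ is the monoid with identity $1$ (the empty word) generated by $a_1,\dots,a_n$ subject to the following relations, where generator indices such as $i+1,i+2$ in (R5) are read modulo $n$ with representatives in $\{1,\dots,n\}$: (R1) $a_i^2=a_i$ for $1\le i\le n$; (R2) $a_ia_j=a_ja_i$ for all $1\le i,j\le n$ with $|i-j|>1$ and $\{i,j\}\neq\{1,n\}$; (R3) $a_ia_{i+1}a_i=a_{i+1}a_ia_{i+1}=a_{i+1}a_i$ for $1\le i<n$; (R4) $a_na_1a_n=a_1a_na_1=a_1a_n$; (R5) $a_ia_{i+1}a_{i+2}=a_ia_{i+2}$ for $1\le i\le n$. All letter indices in the claim are read modulo $n$. *)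

(* Defs.v *)
From mathcomp Require Import all_boot.

Set Implicit Arguments.
Unset Strict Implicit.
Unset Printing Implicit Defensive.

(* Equality in the monoid presented by the relations R over the alphabet A:
   the least congruence on words containing R. *)
Inductive presented_eq (A : Type) (R : seq A -> seq A -> Prop) :
    seq A -> seq A -> Prop :=
| presented_rel u v x y : R x y -> presented_eq R (u ++ x ++ v) (u ++ y ++ v)
| presented_refl x : presented_eq R x x
| presented_sym x y : presented_eq R x y -> presented_eq R y x
| presented_trans x y z :
    presented_eq R x y -> presented_eq R y z -> presented_eq R x z.

(* The letter a_(i+1) is the ordinal i : 'I_n, so the extreme letters a_1 and
   a_n are the ordinals of values 0 and n.-1.  The letter following i modulo n
   is ordS i. *)
Inductive LC_rel (n : nat) : seq 'I_n -> seq 'I_n -> Prop :=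
| LC_R1 (i : 'I_n) : LC_rel [:: i; i] [:: i]
| LC_R2 (i j : 'I_n) :
    (i.+1 < j) || (j.+1 < i) -> ~~ ((minn i j == 0) && (maxn i j == n.-1)) ->
    LC_rel [:: i; j] [:: j; i]
| LC_R3l (i j : 'I_n) : j = i.+1 :> nat -> LC_rel [:: i; j; i] [:: j; i; j]
| LC_R3r (i j : 'I_n) : j = i.+1 :> nat -> LC_rel [:: j; i; j] [:: j; i]
| LC_R4l (i j : 'I_n) : i = 0 :> nat -> j = n.-1 :> nat ->
    LC_rel [:: j; i; j] [:: i; j; i]
| LC_R4r (i j : 'I_n) : i = 0 :> nat -> j = n.-1 :> nat ->
    LC_rel [:: i; j; i] [:: i; j]
| LC_R5 (i : 'I_n) :
    LC_rel [:: i; ordS i; ordS (ordS i)] [:: i; ordS (ordS i)].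

Definition LC_eq (n : nat) : seq 'I_n -> seq 'I_n -> Prop :=
  presented_eq (@LC_rel n).

Definition cdist (n : nat) (i j : 'I_n) : nat := (j + (n - i)) %% n.

(* (i, j) stands for the clockwise arc [i, j] = i, i + 1, ..., j. *)
Definition segment (n : nat) : Type := ('I_n * 'I_n)%type.

Definition positions (n : nat) (s : segment n) : seq 'I_n :=
  traject (@ordS n) s.1 (cdist s.1 s.2).+1.

(* l is one of the positions s.2 + 1, ..., t.1 - 1.  Distances are measured
   from s.2 + 1 and not from s.2 so that s = t = (i, i) gives all the positions
   other than i. *)
Definition between (n : nat) (s t : segment n) (l : 'I_n) : bool :=
  cdist (ordS s.2) l < cdist (ordS s.2) t.1.

Definition clockwise (n : nat) (S : seq (segment n)) : bool :=
  if S is s0 :: _ then sorted ltn [seq cdist s0.1 s.1 | s <- S] else true.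

Definition two_gap (n : nat) (W : seq 'I_n) : Prop :=
  exists r : 'I_n, (ordS r \notin W) /\ (ordS (ordS r) \notin W).

Record represents (n : nat) (W : seq 'I_n) (S : seq (segment n)) : Prop := {
  repr_nonempty : S <> [::];
  repr_length : {in S, forall s, (cdist s.1 s.2).+1 < n};
  repr_disjoint : pairwise (fun s t => [disjoint positions s & positions t]) S;
  repr_clockwise : clockwise S;
  repr_not_full : exists l : 'I_n, {in S, forall s, l \notin positions s};
  repr_ends : {in S, forall s, (s.1 \in W) /\ (s.2 \in W)};
  repr_gaps : {in S, forall s,
    [/\ ord_pred (ord_pred s.1) \notin W, ord_pred s.1 \notin W,
        ordS s.2 \notin W & ordS (ordS s.2) \notin W]};
  repr_inside : {in S, forall s, forall l, l \in positions s ->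
    ~ ((l \notin W) /\ (ordS l \notin W))};
  (* next is cyclic: the last segment is followed by the first one, which is
     the same one if there is a single segment. *)
  repr_between : {in S, forall s, forall l, between s (next S s) l ->
    l \notin W}
}.

Definition occurs_before (n : nat) (W : seq 'I_n) (x y : 'I_n) : bool :=
  [exists l' : 'I_(size W), exists l : 'I_(size W),
    [&& l' < l, tnth (in_tuple W) l' == x & tnth (in_tuple W) l == y]].

Definition segment_word (n : nat) (W : seq 'I_n) (s : segment n) : seq 'I_n :=
  let i := s.1 in
  let d := cdist s.1 s.2 in
  if d == 0 then [:: i]
  else if d == 1 then
    if occurs_before W (ordS i) i then [:: ordS i; i] else [:: i; ordS i]
  else if ~~ odd d then [seq iter t.*2 (@ordS n) i | t <- iota 0 d./2.+1]
  else i :: [seq iter t.*2.+1 (@ordS n) i | t <- iota 0 d./2.+1].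

Definition segment_words (n : nat) (W : seq 'I_n) (S : seq (segment n)) :
    seq (seq 'I_n) :=
  [seq segment_word W s | s <- S].

(* Main.v *)
Require Import Defs.
From Stdlib Require Import Setoid Morphisms.
From mathcomp Require Import all_boot zify.

(* The relations are invariant under rotation of the indices, and they only
   ever insert a letter both of whose neighbours occur; hence the closure of the
   content, obtained by adding every position with both neighbours in the
   content, is an invariant, and the segments are the runs of this closure.

   Letters of different segments commute, so a word is the product of its
   restrictions to the segments.  A segment does not go round the whole circle,
   so it can be studied on a line.  There, a word absorbs on the right every
   letter of its closure, except possibly the first letter of a run of length 2
   (induction on the word).  If the closure is a single run 0, ..., d with
   d >= 2, then W = W * (0 1 ... d); on the other hand 0 1 ... d absorbs its
   letters on the left, so W * (0 1 ... d) = 0 1 ... d, and the layer relation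
   shortens this word to the announced one.

   In a run {i, i + 1} no relation can insert or delete a letter, so whether
   a_{i+1} occurs before a_i is an invariant as well. *)

Set Implicit Arguments.
Unset Strict Implicit.
Unset Printing Implicit Defensive.

(** * Compatibility of the presented congruence with concatenation *)

Section PresentedEq.
Variables (A : Type) (R : seq A -> seq A -> Prop).

Lemma presented_cat u v x y :
  presented_eq R x y -> presented_eq R (u ++ x ++ v) (u ++ y ++ v).
Proof.
elim=> [u' v' x' y' xy | x' | x' y' _ | x' y' z _ xy _ yz].
- rewrite -!catA 2!(catA u u').
  exact: (presented_rel (u ++ u') (v' ++ v) xy).
- exact: presented_refl.
- exact: presented_sym.
- exact: presented_trans xy yz.
Qed.

End PresentedEq.

#[export] Instance presented_Equivalence A (R : seq A -> seq A -> Prop) :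
  Equivalence (presented_eq R).
Proof.
split; [exact: presented_refl | exact: presented_sym |].
by move=> x y z; apply: presented_trans.
Qed.

#[export] Instance cat_presented A (R : seq A -> seq A -> Prop) :
  Proper (presented_eq R ==> presented_eq R ==> presented_eq R) (@cat A).
Proof.
move=> x x' xx' y y' yy'; transitivity (x ++ y').
  by have := presented_cat x [::] yy'; rewrite !cats0.
by have := presented_cat [::] y' xx'.
Qed.

#[export] Instance cons_presented A (R : seq A -> seq A -> Prop) (a : A) :
  Proper (presented_eq R ==> presented_eq R) (cons a).
Proof.
by move=> x y xy; have := presented_cat [:: a] [::] xy; rewrite /= !cats0.
Qed.

#[export] Hint Resolve presented_refl : core.

Lemma presented_cons_rel A (R : seq A -> seq A -> Prop) x y s :
  R x y -> presented_eq R (x ++ s) (y ++ s).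
Proof. exact: (presented_rel [::]). Qed.

Lemma presented_of_rel A (R : seq A -> seq A -> Prop) x y :
  R x y -> presented_eq R x y.
Proof. by move/(presented_cons_rel [::]); rewrite !cats0. Qed.

(** * Words on a line *)

(* Letters range over all of nat, without wrap-around: a segment of LC_n is the
   image of an initial part of this monoid. *)
Inductive line_rel : seq nat -> seq nat -> Prop :=
| line_idem i : line_rel [:: i; i] [:: i]
| line_comm i j : i.+1 < j -> line_rel [:: i; j] [:: j; i]
| line_braidl i : line_rel [:: i; i.+1; i] [:: i.+1; i]
| line_braidr i : line_rel [:: i.+1; i; i.+1] [:: i.+1; i]
| line_layer i : line_rel [:: i; i.+1; i.+2] [:: i; i.+2].

Local Notation "x ~~~ y" := (presented_eq line_rel x y) (at level 70).

Section LineWords.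
Implicit Types (a b : nat) (s U W : seq nat).

Lemma lidem a s : a :: a :: s ~~~ a :: s.
Proof. exact: (presented_cons_rel s (line_idem a)). Qed.

Lemma lcomm a b s : a.+1 < b -> a :: b :: s ~~~ b :: a :: s.
Proof. by move=> /line_comm; apply: presented_cons_rel. Qed.

Lemma lbraidl a s : a :: a.+1 :: a :: s ~~~ a.+1 :: a :: s.
Proof. exact: (presented_cons_rel s (line_braidl a)). Qed.

Lemma lbraidr a s : a.+1 :: a :: a.+1 :: s ~~~ a.+1 :: a :: s.
Proof. exact: (presented_cons_rel s (line_braidr a)). Qed.

Lemma llayer a s : a :: a.+1 :: a.+2 :: s ~~~ a :: a.+2 :: s.
Proof. exact: (presented_cons_rel s (line_layer a)). Qed.

(** A braid relation creates a second [a.+2] after [a.+1]; moving [a] next to [a.+1] exposes the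
    left side of the layer relation, which removes [a.+1]. *)
Lemma layer_absorbr a s : a :: a.+2 :: a.+1 :: s ~~~ a :: a.+2 :: s.
Proof.
rewrite -[X in a :: X](lbraidr a.+1 s) lcomm // llayer -lcomm //.
by rewrite (lidem a.+2).
Qed.

Lemma layer_absorbl a s : a.+1 :: a :: a.+2 :: s ~~~ a :: a.+2 :: s.
Proof.
by rewrite -(lbraidl a) (@lcomm a a.+2) // llayer -(@lcomm a a.+2) // lidem.
Qed.

(** Both sides are shortenings of [a, a.+1, a.+2, a.+3] by the layer relation, starting at [a.+1]
    and at [a] respectively. *)
Lemma layer_shift a s :
  a :: a.+1 :: a.+3 :: s ~~~ a :: a.+2 :: a.+3 :: s.
Proof. by rewrite -(llayer a.+1) llayer. Qed.

Lemma layer_shift_absorb a s :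
  a :: a.+1 :: a :: a.+3 :: s ~~~ a :: a.+1 :: a.+3 :: s.
Proof.
rewrite (@lcomm a a.+3) // !layer_shift -(@lcomm a a.+3) //.
by rewrite -(@lcomm a a.+2) // lidem.
Qed.

(* As 0.-1 = 0, the second disjunct adds nothing at x = 0. *)
Definition lclosure W (x : nat) : bool :=
  (x \in W) || (x.-1 \in W) && (x.+1 \in W).

Definition absorbs W (x : nat) : Prop := W ++ [:: x] ~~~ W.

(* x and x + 1 form a run of length 2 in the closure; this is the only
   situation in which a letter of the closure may fail to be absorbed. *)
Definition short_run W (x : nat) : bool :=
  [&& ~~ ((0 < x) && lclosure W x.-1), lclosure W x.+1 & ~~ lclosure W x.+2].

(** The second field strengthens the induction: the first letter of a short run may fail to be
    absorbed, but the word can still be made to end in [x, x.+1], so the effect of appending a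
    letter can be computed on a known suffix. *)
Record absorbing W : Prop := {
  absorbing_letter x : lclosure W x -> absorbs W x \/ short_run W x;
  absorbing_pair x : lclosure W x -> lclosure W x.+1 ->
    exists U, W ~~~ U ++ [:: x; x.+1]
}.

Lemma absorbs_eq W V x : W ~~~ V -> absorbs V x -> absorbs W x.
Proof. by rewrite /absorbs => WV Vx; rewrite WV Vx. Qed.

Lemma absorbs_rcons W y x : (x.+1 < y) || (y.+1 < x) ->
  absorbs W x -> absorbs (W ++ [:: y]) x.
Proof.
rewrite /absorbs -catA /= => xy Wx.
have -> : [:: y; x] ~~~ [:: x; y].
  by case/orP: xy => xy; [rewrite -lcomm | rewrite lcomm].
by rewrite (catA W [:: x] [:: y]) Wx.
Qed.

Lemma pair_rcons U W x y : (x.+2 < y) || (y.+1 < x) ->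
  W ~~~ U ++ [:: x; x.+1] ->
  W ++ [:: y] ~~~ (U ++ [:: y]) ++ [:: x; x.+1].
Proof.
move=> xy ->; rewrite -!catA /=.
have xy1 s : [:: x, y & s] ~~~ [:: y, x & s].
  by case/orP: xy => xy; [rewrite lcomm // ltnW | rewrite -lcomm].
have -> : [:: x.+1; y] ~~~ [:: y; x.+1].
  by case/orP: xy => xy; [rewrite lcomm | rewrite -lcomm // ltnW].
by rewrite xy1.
Qed.

(** Either [y] is absorbed and nothing changes, or [y] starts a short run; then [W] ends in
    [y, y.+1], and appending [y] turns this suffix into [y.+1, y], which absorbs both letters. *)
Lemma absorbing_rcons_in W y : absorbing W -> lclosure W y ->
  absorbing (W ++ [:: y]).
Proof.
move=> [Wl Wp] cy.
(* The closure does not grow: if [y] is missing from [W], both of its neighbours already occur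
   there. *)
have cE x : lclosure (W ++ [:: y]) x = lclosure W x.
  move: cy; rewrite /lclosure !mem_cat !inE.
  case: (eqVneq x y) => [->|]; first by lia.
  case: (eqVneq x.-1 y) => [<-|].
    by case: x => [|x] /=; lia.
  by case: (eqVneq x.+1 y) => [<-|] /=; lia.
have sE x : short_run (W ++ [:: y]) x = short_run W x.
  by rewrite /short_run !cE.
case: (Wl y cy) => [Wy | sy].
  split=> [x | x]; rewrite !cE ?sE.
    move=> cx; case: (Wl x cx) => [Wx|]; last by right.
    by left; apply: absorbs_eq Wy Wx.
  by move=> cx cx1; have [U WU] := Wp x cx cx1; exists U; rewrite Wy.
have [//|U WU] := Wp y cy; first by case/and3P: sy.
have VU : W ++ [:: y] ~~~ U ++ [:: y.+1; y].
  by rewrite WU -catA /= lbraidl.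
have Vy : absorbs (W ++ [:: y]) y.
  by apply: absorbs_eq VU _; rewrite /absorbs -catA /= lidem.
have Vy1 : absorbs (W ++ [:: y]) y.+1.
  by apply: absorbs_eq VU _; rewrite /absorbs -catA /= lbraidr.
case/and3P: sy => sy1 sy2 sy3.
split=> [x | x]; rewrite !cE ?sE.
  move=> cx.
  case: (eqVneq x y) => [->|xy]; first by left.
  case: (eqVneq x y.+1) => [->|xy1]; first by left.
  have xy2 : x.+1 != y.
    by apply/negP => /eqP E; move: sy1; rewrite -E /= cx.
  case: (Wl x cx) => [Wx|]; last by right.
  by left; apply: absorbs_rcons Wx; lia.
move=> cx cx1.
case: (eqVneq x y) => [->|xy].
  by exists (W ++ [:: y]); rewrite -{1}Vy1 -{1}Vy -!catA.
have xy1 : x != y.+1.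
  by apply/negP => /eqP E; move: sy3; rewrite -E cx1.
have xy2 : x.+1 != y.
  by apply/negP => /eqP E; move: sy1; rewrite -E /= cx.
have xy3 : x.+2 != y.
  by apply/negP => /eqP E; move: sy1; rewrite -E /= cx1.
have [V WV] := Wp x cx cx1.
by exists (V ++ [:: y]); apply: pair_rcons WV; lia.
Qed.

Lemma absorbing_end W x : absorbing W -> lclosure W x ->
  exists U, W ~~~ U ++ [:: x] \/ W ~~~ U ++ [:: x; x.+1].
Proof.
move=> [Wl Wp] cx; case: (Wl x cx) => [Wx | /and3P[_ cx1 _]].
  by exists W; left; rewrite Wx.
by have [U WU] := Wp x cx cx1; exists U; right.
Qed.

Lemma absorbing_top W x : absorbing W -> lclosure W x -> ~~ lclosure W x.+1 ->
  absorbs W x.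
Proof.
move=> [Wl _] cx ncx1; case: (Wl x cx) => // /and3P[_ cx1 _].
by rewrite cx1 in ncx1.
Qed.

Lemma absorbs_suffix W U t x : W ~~~ U ++ t -> t ++ [:: x] ~~~ t -> absorbs W x.
Proof. by move=> WU tx; apply: absorbs_eq WU _; rewrite /absorbs -catA tx. Qed.

(** * Appending a letter outside the closure *)

Section NewLetter.
Variables (W : seq nat) (y : nat).
Hypotheses (Wabs : absorbing W) (ncy : ~~ lclosure W y).

Local Notation V := (W ++ [:: y]).

Lemma new_letter_notin : y \notin W.
Proof. by move: ncy; rewrite /lclosure; lia. Qed.

Lemma closure_rcons_sub x : lclosure W x -> lclosure V x.
Proof.
by rewrite /lclosure !mem_cat !inE => /orP[->|/andP[-> ->]]; rewrite ?orbT.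
Qed.

Lemma closure_rcons_far x : (x.+1 < y) || (y.+1 < x) ->
  lclosure V x = lclosure W x.
Proof.
move=> xy; rewrite /lclosure !mem_cat !inE.
have -> : (x == y) = false by lia.
have -> : (x.-1 == y) = false by lia.
have -> : (x.+1 == y) = false by lia.
by rewrite !orbF.
Qed.

Lemma closure_rcons_next : lclosure V y.+1 = (y.+1 \in W) || (y.+2 \in W).
Proof.
move: new_letter_notin; rewrite /lclosure !mem_cat !inE /=.
have -> : (y.+1 == y) = false by lia.
have -> : (y.+2 == y) = false by lia.
by rewrite eqxx; lia.
Qed.

Lemma closure_rcons_same : lclosure V y.
Proof. by rewrite /lclosure mem_cat inE eqxx orbT. Qed.

(** One of [y.+1], [y.+2] occurs in [W] and can be brought to its end, followed at most by its
    successor. Each of the four resulting suffixes, completed by [y], absorbs [y.+1]. *)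
Lemma new_letter_next : lclosure V y.+1 -> absorbs V y.+1.
Proof.
rewrite closure_rcons_next.
case: (boolP (y.+1 \in W)) => [y1W _ | _ /= y2W].
  have cy1 : lclosure W y.+1 by rewrite /lclosure y1W.
  have [U [] WU] := absorbing_end Wabs cy1.
    apply: (@absorbs_suffix _ U [:: y.+1; y]); last by rewrite /= lbraidr.
    by rewrite WU -catA.
  apply: (@absorbs_suffix _ U [:: y.+1; y.+2; y]).
    by rewrite WU -catA.
  by rewrite /= -!(@lcomm y y.+2) // !layer_absorbl layer_absorbr.
have cy2 : lclosure W y.+2 by rewrite /lclosure y2W.
have [U [] WU] := absorbing_end Wabs cy2.
  apply: (@absorbs_suffix _ U [:: y.+2; y]).
    by rewrite WU -catA.
  by rewrite /= -!(@lcomm y y.+2) // layer_absorbr.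
apply: (@absorbs_suffix _ U [:: y.+2; y.+3; y]).
  by rewrite WU -catA.
rewrite /= -!(@lcomm y y.+3) // -!(@lcomm y y.+2) //.
by rewrite -(@lcomm y.+1 y.+3) // layer_absorbr.
Qed.

Hypothesis y_gt0 : 0 < y.

Lemma closure_rcons_prev : lclosure V y.-1 = (y.-1 \in W) || (y.-2 \in W).
Proof.
move: new_letter_notin; rewrite /lclosure !mem_cat !inE /= prednK // eqxx.
have -> : (y.-1 == y) = false by lia.
have -> : (y.-2 == y) = false by lia.
by lia.
Qed.

Lemma new_letter_prev : lclosure V y.-1 ->
  absorbs V y.-1 \/ short_run V y.-1.
Proof.
rewrite closure_rcons_prev /short_run.
have [x yE] : exists x, y = x.+1 by exists y.-1; rewrite prednK.
have ncx1 := ncy; rewrite yE in ncx1.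
rewrite yE /=.
case: (boolP (x \in W)) => [xW _ | nxW /= zW]; last first.
  case: x {ncx1} => [|z] in yE nxW zW *; first by rewrite zW in nxW.
  have cz : lclosure W z by rewrite /lclosure zW.
  (* [z.+1] does not occur, and its neighbour [z.+2], which is [y], does not occur either. *)
  have ncz1 : ~~ lclosure W z.+1.
    move: ncy; rewrite /lclosure yE /= (negbTE nxW) /= => /norP[/negbTE -> _].
    by rewrite andbF.
  left; have Wz := absorbing_top Wabs cz ncz1.
  apply: (@absorbs_suffix _ W [:: z; z.+2]); last by rewrite /= layer_absorbr.
  by rewrite -{1}Wz -catA.
have cx : lclosure W x by rewrite /lclosure xW.
have Wx := absorbing_top Wabs cx ncx1.
(* If the run of [x] extends to the left, then [W] can end in [z, z.+1] with [x = z.+1], and [y]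
   completes a layer triple. *)
case: (boolP ((0 < x) && _)) => [/andP[x_gt0 cz] | _] /=.
  left; case: x x_gt0 => [//|z] _ in yE ncx1 xW cx Wx cz *.
  rewrite /= -yE closure_rcons_far in cz; last by rewrite yE; lia.
  have [U WU] := absorbing_pair Wabs cz cx.
  apply: (@absorbs_suffix _ U [:: z; z.+1; z.+2]).
    by rewrite WU -catA.
  by rewrite /= !llayer layer_absorbr.
have := closure_rcons_next; have := closure_rcons_same; rewrite yE => -> ->.
(* Otherwise [y = x.+1] would have both neighbours in [W] and lie in its closure. *)
have -> : (x.+2 \in W) = false.
  by apply: contraNF ncx1; rewrite /lclosure /= xW => ->; rewrite orbT.
(* If [x.+3] occurs, [y] joins its run to that of [x], so the run of [x] is no longer short;
   otherwise [x, x.+1] is a short run. *)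
case: (boolP (x.+3 \in W)) => [dW|_] /=; last by right.
have cd : lclosure W x.+3 by rewrite /lclosure dW.
left; have [U [] WU] := absorbing_end Wabs cd.
  apply: (@absorbs_suffix _ U [:: x.+3; x; x.+1]).
    by rewrite -{1}Wx WU -!catA.
  by rewrite /= -!(@lcomm _ x.+3) // layer_shift_absorb.
apply: (@absorbs_suffix _ U [:: x.+3; x.+4; x; x.+1]).
  by rewrite -{1}Wx WU -!catA.
have x4 : x.+1 < x.+4 by rewrite ltnS ltnW.
rewrite /= -!(@lcomm _ x.+4) // -!(@lcomm x x.+3) // -!(@lcomm x.+1 x.+3) //.
by rewrite -(@lcomm x x.+3) // layer_shift_absorb.
Qed.

End NewLetter.

(** An absorbed [x] commutes with [y]. If instead [x] starts a short run of [W], that run can only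
    stop being short when [y] is [x - 2], [x + 2] or [x + 3], and then the suffix [x, x.+1] together
    with [y] absorbs [x]. *)
Lemma new_letter_far W y x : absorbing W -> ~~ lclosure W y ->
  (x.+1 < y) || (y.+1 < x) -> lclosure W x ->
  absorbs (W ++ [:: y]) x \/ short_run (W ++ [:: y]) x.
Proof.
move=> Wabs ncy xy cx.
case: (absorbing_letter Wabs cx) => [Wx|]; first by left; apply: absorbs_rcons.
case/and3P=> pcx cx1 ncx2; have [U WU] := absorbing_pair Wabs cx cx1.
rewrite /short_run (closure_rcons_sub y cx1) /=.
case: (boolP ((0 < x) && _)) => [/andP[x_gt0 cpx] | _] /=.
  have yE : x = y.+2.
    case: (boolP ((x.-1.+1 < y) || (y.+1 < x.-1))) => far; last by lia.
    by rewrite closure_rcons_far // in cpx; rewrite x_gt0 cpx in pcx.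
  left; apply: (@absorbs_suffix _ U [:: y.+2; y.+3; y]).
    by rewrite WU -catA yE.
  rewrite /= yE -!(@lcomm y y.+3) // -!(@lcomm y y.+2) //.
  by rewrite -(llayer y) (llayer y.+1) layer_absorbr layer_shift.
case: (boolP (lclosure _ x.+2)) => [cx2 | _] /=; last by right.
left; case: (boolP ((x.+3 < y) || (y.+1 < x.+2))) => far.
  by rewrite closure_rcons_far // (negbTE ncx2) in cx2.
have [yE|yE] : y = x.+2 \/ y = x.+3 by lia.
  apply: (@absorbs_suffix _ U [:: x; x.+1; x.+2]).
    by rewrite WU -catA yE.
  by rewrite /= !llayer -(@lcomm x x.+2) // lidem.
apply: (@absorbs_suffix _ U [:: x; x.+1; x.+3]).
  by rewrite WU -catA yE.
by rewrite /= -(@lcomm x x.+3) // layer_shift_absorb.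
Qed.

Lemma new_letter W y x : absorbing W -> ~~ lclosure W y ->
  lclosure (W ++ [:: y]) x ->
  absorbs (W ++ [:: y]) x \/ short_run (W ++ [:: y]) x.
Proof.
move=> Wabs ncy cx.
case: (eqVneq x y) => [->|xy].
  by left; rewrite /absorbs -catA /= lidem.
case: (eqVneq x y.+1) => [xE|xy1].
  by left; rewrite xE; apply: new_letter_next => //; rewrite -xE.
case: (eqVneq x.+1 y) => [yE|xy2].
  have xE : x = y.-1 by rewrite -yE.
  rewrite xE; apply: new_letter_prev => //; first by rewrite -yE.
  by rewrite -xE.
have far : (x.+1 < y) || (y.+1 < x) by lia.
by apply: new_letter_far => //; rewrite closure_rcons_far in cx.
Qed.

(** If [x] is absorbed then so is [x.+1], which cannot start a run, and both may simply be appended.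
    If [x] starts a short run, the cases [y = x], [y = x.+1] and [y] away from the run are treated
    separately. *)
Lemma absorbing_rcons_new W y : absorbing W -> ~~ lclosure W y ->
  absorbing (W ++ [:: y]).
Proof.
move=> Wabs ncy; split=> [x | x cx cx1]; first exact: new_letter.
case: (new_letter Wabs ncy cx) => [Vx|].
  exists (W ++ [:: y]).
  case: (new_letter Wabs ncy cx1) => [Vx1 | /and3P[]]; last by rewrite /= cx.
  by rewrite (catA _ [:: x] [:: x.+1]) Vx Vx1.
case/and3P=> pcx _ ncx2.
case: (eqVneq x y) => [xy|xy].
  (* [W] absorbs [x.+1], so it may be inserted before the new [x]; the braid relation then produces
     a second [x.+1] at the end. *)
  exists (W ++ [:: x.+1]); rewrite -catA /=.
  have cWx1 : lclosure W x.+1.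
    move: cx1 ncx2; rewrite xy closure_rcons_next // => /orP[y1|y2].
      by rewrite /lclosure y1.
    by rewrite closure_rcons_sub // /lclosure y2.
  case: (absorbing_letter Wabs cWx1) => [Wx1|]; last first.
    case/and3P=> _ cx2 _; move: ncx2.
    by rewrite xy in cx2 *; rewrite closure_rcons_sub.
  by rewrite lbraidr -{1}Wx1 -xy -catA.
case: (eqVneq x.+1 y) => [xy1|xy1].
  exists W.
  have cWx : lclosure W x.
    have y_gt0 : 0 < y by rewrite -xy1.
    have := closure_rcons_prev ncy y_gt0.
    rewrite -xy1 /= in cx *; rewrite cx => /esym/orP[xW|pxW].
      by rewrite /lclosure xW.
    case: x {xy cx cx1 ncx2} xy1 pcx pxW => [|z] /= xy1 pcx zW.
      by rewrite /lclosure zW.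
    by move: pcx; rewrite -xy1 /lclosure mem_cat zW.
  have Wx : absorbs W x by apply: absorbing_top; rewrite ?xy1.
  by rewrite -{1}Wx -catA xy1.
have xy2 : x != y.+1.
  by apply: contra pcx => /eqP ->; rewrite /= closure_rcons_same.
have xy3 : x.+2 != y.
  by apply: contra ncx2 => /eqP ->; rewrite closure_rcons_same.
have far : (x.+2 < y) || (y.+1 < x) by lia.
have cWx : lclosure W x by rewrite closure_rcons_far in cx => //; lia.
have cWx1 : lclosure W x.+1 by rewrite closure_rcons_far in cx1 => //; lia.
have [U WU] := absorbing_pair Wabs cWx cWx1.
by exists (U ++ [:: y]); apply: pair_rcons.
Qed.

Lemma all_absorbing W : absorbing W.
Proof.
elim/last_ind: W => [|W y IH]; first by split.
rewrite -cats1; case: (boolP (lclosure W y)) => cy.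
  exact: absorbing_rcons_in.
exact: absorbing_rcons_new.
Qed.

End LineWords.

(** * Normal forms of words on the line *)

Section LineNormalForms.
Implicit Types (m x d k : nat) (s W : seq nat).

Lemma iota_absorbl m n x : 2 < n -> m <= x < m + n ->
  x :: iota m n ~~~ iota m n.
Proof.
(* The induction starts at length 3, the shortest interval that absorbs each of its letters on the
   left; a letter beyond the first two commutes with the first one and passes to the shorter
   interval. *)
case: n => [|[|[|n]]] // _; elim: n m => [|n IH] m xm; last first.
  case: (eqVneq x m) => [->|xm0]; first by rewrite lidem.
  case: (eqVneq x m.+1) => [->|xm1].
    by rewrite /= llayer layer_absorbl.
  rewrite -[iota m _]/(m :: iota m.+1 n.+3) -lcomm; last by lia.
  by rewrite IH //; lia.
have [->|->|->] : [\/ x = m, x = m.+1 | x = m.+2].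
- by case: (eqVneq x m); case: (eqVneq x m.+1); try (by constructor);
    constructor 3; lia.
- by rewrite /= lidem.
- by rewrite /= llayer layer_absorbl.
by rewrite /= -(@lcomm m m.+2) // lbraidr layer_absorbr llayer.
Qed.

Lemma line_full d W : 1 < d -> {in W, forall k, k <= d} ->
  0 \in W -> d \in W ->
  (forall k, k < d -> (k \in W) || (k.+1 \in W)) ->
  W ~~~ iota 0 d.+1.
Proof.
move=> d2 Wd W0 Wdd Wgap.
have clW k : k <= d -> lclosure W k.
  move=> kd; rewrite /lclosure; case: (boolP (k \in W)) => //= kW.
  have k_lt : k < d.
    by rewrite ltn_neqAle kd andbT; apply: contraNneq kW => ->.
  have := Wgap k k_lt; rewrite (negbTE kW) /= => ->.
  case: k kW kd k_lt => [|k] kW kd k_lt; first by rewrite W0 in kW.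
  by have := Wgap k (ltnW k_lt); rewrite (negbTE kW) orbF => ->.
have abs k : k <= d -> absorbs W k.
  move=> kd.
  case: (absorbing_letter (all_absorbing W) (clW k kd)) => // /and3P[].
  (* No short run exists: [1 < d] puts 2 in the closure, which excludes one starting at 0, and any
     other letter has its predecessor in the closure. *)
  case: k kd => [|k] kd; first by rewrite (clW 2).
  by rewrite /= (clW k) // ltnW.
have absr s : {in s, forall k, k <= d} -> W ++ s ~~~ W.
  elim: s => [|k s IH] ks; first by rewrite cats0.
  rewrite -cat1s catA abs ?ks ?mem_head //.
  by apply: IH => l ls; apply: ks; rewrite inE ls orbT.
have absl s : {in s, forall k, k <= d} -> s ++ iota 0 d.+1 ~~~ iota 0 d.+1.
  elim: s => [|k s IH] ks //.
  rewrite cat_cons IH => [|l ls]; last by apply: ks; rewrite inE ls orbT.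
  by apply: iota_absorbl => //; rewrite add0n ltnS ks ?mem_head.
by rewrite -(absl W) // absr // => k; rewrite mem_iota.
Qed.

Lemma line_evens m k :
  iota m k.*2.+1 ~~~ [seq m + t.*2 | t <- iota 0 k.+1].
Proof.
elim: k m => [|k IH] m; first by rewrite /= addn0.
rewrite doubleS -[iota m _]/(m :: m.+1 :: iota m.+2 k.*2.+1) IH.
rewrite -[iota 0 k.+2]/(0 :: iota 1 k.+1) (iotaDl 1 0) map_cons -map_comp.
rewrite addn0 (@eq_map _ _ (_ \o _) (fun t => m.+2 + t.*2)); last first.
  by move=> t /=; rewrite doubleS !addSn !addnS.
by rewrite -[iota 0 k.+1]/(0 :: iota 1 k) map_cons addn0 llayer.
Qed.

Lemma line_single k s : all (pred1 k) s -> k :: s ~~~ [:: k].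
Proof. by elim: s => [|l s IH] //= /andP[/eqP-> /IH ks]; rewrite lidem. Qed.

Lemma line_pair W : {in W, forall k, k <= 1} -> 0 \in W -> 1 \in W ->
  W ~~~ if subseq [:: 1; 0] W then [:: 1; 0] else [:: 0; 1].
Proof.
move=> W1.
(* The statement is extended to words missing 0 or 1, so that it passes to the tail of [W]. *)
suff : W ~~~ if 0 \in W then
    if 1 \in W then if subseq [:: 1; 0] W then [:: 1; 0] else [:: 0; 1]
    else [:: 0]
  else if 1 \in W then [:: 1] else [::].
  by move=> + W0 W1'; rewrite W0 W1'.
elim: W W1 => [|k W IH] W1 //.
have {}IH := IH (fun l lW => W1 l (mem_behead (s := k :: W) lW)).
rewrite {1}IH !inE /=.
have [->|->] : k = 0 \/ k = 1 by have := W1 k (mem_head _ _); lia.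
  case: (boolP (0 \in W)) => W0 /=.
    case: ifP => _; last by rewrite lidem.
    by case: ifP => _; rewrite ?lidem ?lbraidl.
  case: ifP => // _; case: ifP => // /mem_subseq/(_ 0).
  by rewrite !inE (negbTE W0) => /(_ isT).
rewrite sub1seq /=.
by case: ifP => _; case: ifP => _; try case: ifP => _; rewrite ?lidem ?lbraidr.
Qed.

End LineNormalForms.

(** * The circle *)

Section Circle.
Variable n : nat.
Implicit Types (i j l x y : 'I_n) (W : seq 'I_n).

Lemma val_ordS i : ordS i = (if i.+1 == n then 0 else i.+1) :> nat.
Proof.
rewrite /=; case: eqP => [->|ni]; first by rewrite modnn.
by rewrite modn_small // ltn_neqAle ltn_ord andbT; apply/eqP.
Qed.

Lemma val_iter_ordS k i : iter k (@ordS n) i = (i + k) %% n :> nat.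
Proof.
elim: k => [|k IH]; first by rewrite addn0 modn_small.
by rewrite iterS /= IH -addn1 modnDml addn1 addnS.
Qed.

Lemma cdist_iter i k : cdist i (iter k (@ordS n) i) = k %% n.
Proof.
rewrite /cdist val_iter_ordS modnDml.
by rewrite addnAC subnKC ?modnDl // ltnW.
Qed.

Lemma iter_cdist i j : iter (cdist i j) (@ordS n) i = j.
Proof.
apply: val_inj; rewrite /= val_iter_ordS /cdist modnDmr addnCA.
by rewrite subnKC ?modnDr ?modn_small // ltnW.
Qed.

Lemma cdist_lt i j : cdist i j < n.
Proof. by rewrite /cdist ltn_mod; case: n i => [[]|]. Qed.

Lemma cdistii i : cdist i i = 0.
Proof. by rewrite -{2}[i]/(iter 0 (@ordS n) i) cdist_iter mod0n. Qed.

Lemma cdist_eq0 i j : (cdist i j == 0) = (i == j).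
Proof.
apply/eqP/eqP=> [E | ->]; last exact: cdistii.
by rewrite -(iter_cdist i j) E.
Qed.

Lemma iter_ordS_inj i (k l : nat) :
  iter k (@ordS n) i = iter l (@ordS n) i -> k < n -> l < n -> k = l.
Proof.
move=> /(congr1 (cdist i)); rewrite !cdist_iter => + kn ln.
by rewrite !modn_small.
Qed.

(** Cyclic non-adjacency covers both side conditions of [LC_R2]: distance at least 2 on the line,
    and not the pair of extreme letters. *)
Lemma LC_commute x y : x != y -> y != ordS x -> x != ordS y ->
  LC_eq [:: x; y] [:: y; x].
Proof.
rewrite -!val_eqE; have := val_ordS x; have := val_ordS y.
move=> /= -> -> xy yx xy'.
have := ltn_ord x; have := ltn_ord y => yn xn.
apply: presented_of_rel; move: yx xy'.
case: (x.+1 =P n); case: (y.+1 =P n) => yn1 xn1 yx xy'.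
all: by apply: LC_R2; lia.
Qed.

(** The relations [LC_R4l] and [LC_R4r] are the rotated forms of [LC_R3l] and [LC_R3r] at the last
    letter, so both families read the same in terms of [ordS]. *)
Lemma LC_braid x :
  LC_eq [:: x; ordS x; x] [:: ordS x; x] /\
  LC_eq [:: ordS x; x; ordS x] [:: ordS x; x].
Proof.
have := val_ordS x; case: eqP => [xn x0|_ xS].
  have xn1 : x = n.-1 :> nat by move/(congr1 predn): xn.
  have R := presented_of_rel (LC_R4r x0 xn1).
  by split=> //; exact: presented_trans (presented_of_rel (LC_R4l x0 xn1)) R.
have R := presented_of_rel (LC_R3r xS).
by split=> //; exact: presented_trans (presented_of_rel (LC_R3l xS)) R.
Qed.

(* An arc omitting at least one position embeds the letters 0, ..., d of the
   line. *)
Lemma line_to_arc i d u v : d.+1 < n -> u ~~~ v ->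
  all (leq^~ d) u = all (leq^~ d) v /\
  (all (leq^~ d) u -> LC_eq [seq iter k (@ordS n) i | k <- u]
                            [seq iter k (@ordS n) i | k <- v]).
Proof.
move=> dn; rewrite /LC_eq.
elim=> {u v} [u v x y xy | // | x y _ [-> IH] | x y z _ [-> IH1] _ [yz IH2]].
(* Every relation preserves the bound [d], the layer relation because the letter it inserts lies
   below one already present; hence no intermediate word of a derivation leaves the arc. *)
- have [xyd LCxy] : all (leq^~ d) x = all (leq^~ d) y /\
    (all (leq^~ d) x -> LC_eq [seq iter k (@ordS n) i | k <- x]
                              [seq iter k (@ordS n) i | k <- y]).
    case: xy => {u v x y} [k | k l kl | k | k | k].
    + split=> [/=|_]; first by rewrite !andbT andbb.
      exact: (presented_of_rel (LC_R1 _)).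
    + split=> [/=|/and3P[kd ld _]]; first by rewrite !andbT andbC.
      apply: LC_commute; rewrite -?iterS; apply/eqP => /iter_ordS_inj; lia.
    + split=> [/=|_]; first by case: (k <= d) (k < d) => [] [].
      by have [] := LC_braid (iter k (@ordS n) i).
    + split=> [/=|_]; first by case: (k <= d) (k < d) => [] [].
      by have [] := LC_braid (iter k (@ordS n) i).
    split=> [/=|_]; first by lia.
    exact: (presented_of_rel (LC_R5 _)).
  rewrite !all_cat xyd; split=> // /and3P[ud yd vd].
  by rewrite !map_cat; apply: presented_cat; apply: LCxy; rewrite xyd.
- by split=> // yd; apply: presented_sym; apply: IH.
by split=> // yd; apply: presented_trans (IH1 yd) (IH2 yd).
Qed.

End Circle.

(** * Decomposition along the segments *)

Section Shuffle.
Variables (A : eqType) (R : seq A -> seq A -> Prop).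
Let commutes x y := presented_eq R [:: x; y] [:: y; x].

Lemma presented_commute x s : {in s, forall y, commutes x y} ->
  presented_eq R (x :: s) (rcons s x).
Proof.
elim: s => [|y s IH] // xs.
have xy : commutes x y by apply: xs; rewrite mem_head.
rewrite rcons_cons -IH => [|z zs]; last by apply: xs; rewrite inE zs orbT.
exact: (cat_presented xy (presented_refl R s)).
Qed.

Lemma presented_shuffle (p : pred A) W :
  {in W &, forall x y, ~~ p x -> p y -> commutes x y} ->
  presented_eq R W (filter p W ++ filter (predC p) W).
Proof.
elim: W => [|x W IH] // xW.
have {}IH : presented_eq R W (filter p W ++ filter (predC p) W).
  by apply: IH => y z yW zW; apply: xW; rewrite inE ?yW ?zW orbT.
apply: presented_trans (cons_presented x IH) _.
rewrite /=; case: ifP => //= px.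
rewrite -cat_cons -cat_rcons; apply: cat_presented => //.
apply: presented_commute => y; rewrite mem_filter => /andP[py yW].
by apply: xW; rewrite ?mem_head ?px // inE yW orbT.
Qed.

(** The classes are pulled to the front one after the other; by disjointness, removing one class
    does not alter the restriction to the later ones. *)
Lemma presented_split (I : eqType) (S : seq I) (P : I -> pred A) W :
  uniq S -> {in W, forall x, has (P^~ x) S} ->
  {in S &, forall s t, s != t -> {in W, forall x, P s x -> ~~ P t x}} ->
  {in S &, forall s t, s != t ->
    {in W &, forall x y, P s x -> P t y -> commutes x y}} ->
  presented_eq R W (flatten [seq filter (P s) W | s <- S]).
Proof.
elim: S W => [|s S IH] W /=.
  by case: W => // x W _ /(_ x (mem_head _ _)).
case/andP=> sS uS cover disj comm.
have neq t : t \in S -> s != t by apply: contraTneq => <-.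
apply: presented_trans (presented_shuffle (p := P s) _) _.
  move=> x y xW yW nPx Py.
  have := cover x xW; rewrite (negbTE nPx) /= => /hasP[t tS Px].
  by apply: (comm t s); rewrite ?mem_head 1?eq_sym ?neq // inE tS orbT.
have subW : {subset filter (predC (P s)) W <= W}.
  by move=> x; rewrite mem_filter => /andP[].
have -> : [seq filter (P t) W | t <- S] =
    [seq filter (P t) (filter (predC (P s)) W) | t <- S].
  apply/eq_in_map => t tS; rewrite -filter_predI; apply: eq_in_filter => x xW.
  rewrite /= andbC; case: (boolP (P s x)) => //= Px.
  by apply/negbTE; apply: (disj s t); rewrite ?mem_head ?neq // inE tS orbT.
apply: cat_presented => //; apply: IH => //.
- by move=> x; rewrite mem_filter => /andP[/= nPx /cover]; rewrite (negbTE nPx).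
- by move=> t u tS uS' tu x /subW; apply: disj; rewrite // inE ?tS ?uS' orbT.
move=> t u tS uS' tu x y /subW xW /subW yW.
by apply: comm; rewrite // inE ?tS ?uS' orbT.
Qed.

End Shuffle.

(** * Arcs and the factorization of a word along its segments *)

Section Arcs.
Variable n : nat.
Implicit Types (i j l x y : 'I_n) (W : seq 'I_n) (s : segment n).

Lemma mem_positions s l :
  (l \in positions s) = (cdist s.1 l <= cdist s.1 s.2).
Proof.
rewrite -ltnS; apply/trajectP/idP => [[k k_lt ->] | ll].
  by rewrite cdist_iter (leq_ltn_trans (leq_mod _ _)).
by exists (cdist s.1 l); rewrite // iter_cdist.
Qed.

Lemma start_positions s : s.1 \in positions s.
Proof. by rewrite mem_positions cdistii. Qed.

Lemma cdist_ordS i j : (cdist i j).+1 < n -> cdist i (ordS j) = (cdist i j).+1.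
Proof.
by move=> ij; rewrite -{1}(iter_cdist i j) -iterS cdist_iter modn_small.
Qed.

Lemma positions_ordS s l : (cdist s.1 s.2).+1 < n ->
  l \in positions s -> l != s.2 -> ordS l \in positions s.
Proof.
rewrite !mem_positions => sn ls ls2.
have ls' : cdist s.1 l < cdist s.1 s.2.
  rewrite ltn_neqAle ls andbT; apply: contra ls2 => /eqP E.
  by rewrite -(iter_cdist s.1 l) E iter_cdist.
by rewrite cdist_ordS //; apply: leq_ltn_trans ls' (ltnW sn).
Qed.

Lemma positions_ord_pred s l :
  l \in positions s -> l != s.1 -> ord_pred l \in positions s.
Proof.
rewrite eq_sym -cdist_eq0 -lt0n => ls l_gt0.
have -> : ord_pred l = iter (cdist s.1 l).-1 (@ordS n) s.1.
  by apply: (can_inj (@ordSK n)); rewrite ord_predK -iterS prednK ?iter_cdist.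
rewrite mem_positions cdist_iter modn_small.
  by apply: leq_trans (leq_pred _) _; rewrite -mem_positions.
exact: leq_ltn_trans (leq_pred _) (cdist_lt _ _).
Qed.

Lemma occurs_before_subseq W x y : occurs_before W x y = subseq [:: x; y] W.
Proof.
apply/existsP/idP => [[k /existsP[l /and3P[kl]]] | xyW].
  rewrite !(tnth_nth x) /= => /eqP kx /eqP ly.
  rewrite -(cat_take_drop l W) -[[:: x; y]]/([:: x] ++ [:: y]).
  apply: cat_subseq; rewrite sub1seq; last first.
    rewrite -ly -[X in nth _ _ X]addn0 -nth_drop mem_nth //.
    by rewrite size_drop subn_gt0.
  by rewrite -kx -(nth_take x kl) mem_nth // size_take ltn_ord.
suff [k [l [kl lW kx ly]]] : exists k (l : nat),
    [/\ k < l, l < size W, nth x W k = x & nth x W l = y].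
  exists (Ordinal (ltn_trans kl lW)); apply/existsP; exists (Ordinal lW).
  by rewrite kl !(tnth_nth x) /= kx ly !eqxx.
elim: W xyW => [|a W IH] //=; case: eqP => [<-|_].
  rewrite sub1seq => /(nthP x)[l lW ly].
  by exists 0, l.+1.
by case/IH=> k [l [kl lW kx ly]]; exists k.+1, l.+1.
Qed.

Section Represents.
Variables (W : seq 'I_n) (S : seq (segment n)).
Hypothesis WS : represents W S.

Lemma represents_disjoint : {in S &, forall s t, s != t ->
  [disjoint positions s & positions t]}.
Proof.
have := repr_disjoint WS; elim: S => [|u S' IH] //= /andP[/allP uS' S'S'] s t.
rewrite !inE => /orP[/eqP->|sS] /orP[/eqP->|tS] st; first by rewrite eqxx in st.
- exact: uS'.
- by rewrite disjoint_sym uS'.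
- exact: IH.
Qed.

Lemma represents_inj s t l : s \in S -> t \in S ->
  l \in positions s -> l \in positions t -> s = t.
Proof.
move=> sS tS ls lt; apply/eqP; apply: contraTT lt => st.
by rewrite (disjointFr (represents_disjoint sS tS st) ls).
Qed.

Lemma represents_uniq : uniq S.
Proof.
have := repr_disjoint WS; elim: S => [|s S' IH] //= /andP[/allP sS' /IH ->].
rewrite andbT; apply/negP => /sS'; rewrite disjoint_has => /hasP[].
by exists s.1; rewrite start_positions.
Qed.

(* The segment starting closest before l contains l, for otherwise l lies
   between that segment and the next one. *)
Lemma represents_cover l : l \in W -> exists2 s, s \in S & l \in positions s.
Proof.
move=> lW.
have [s0 s0S] : exists s, s \in S.
  by case: S (repr_nonempty WS) => // s S' _; exists s; rewrite mem_head.
(* [m] is the least clockwise distance from the start of a segment to [l]. *)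
have /ex_minnP[m /hasP[s sS /eqP sm] m_min] :
    exists m, has (fun s => cdist s.1 l == m) S.
  by exists (cdist s0.1 l); apply/hasP; exists s0.
exists s => //; rewrite mem_positions leqNgt; apply/negP => dl.
suff /(repr_between WS sS) : between s (next S s) l by rewrite lW.
have tS : next S s \in S by rewrite mem_next.
have dn := repr_length WS sS; have ln := cdist_lt s.1 l.
(* Beyond the segment, distances from [ordS s.2], which [between] uses, are distances from [s.1]
   less the length of the segment. *)
have shift j : cdist s.1 s.2 < cdist s.1 j ->
    cdist (ordS s.2) j = cdist s.1 j - (cdist s.1 s.2).+1.
  move=> dj.
  have {1}-> : j = iter (cdist s.1 j - (cdist s.1 s.2).+1) (@ordS n) (ordS s.2).
    by rewrite -{2}(iter_cdist s.1 s.2) -iterS -iterD subnK // iter_cdist.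
  by rewrite cdist_iter modn_small // (leq_ltn_trans (leq_subr _ _)) ?cdist_lt.
rewrite /between (shift l) //.
(* With a single segment, the next start is [s.1] itself, reached from [ordS s.2] by completing the
   full turn. *)
case: (eqVneq (next S s) s) => [->|st].
  have {3}-> : s.1 = iter (n - (cdist s.1 s.2).+1) (@ordS n) (ordS s.2).
    rewrite -{2}(iter_cdist s.1 s.2) -iterS -iterD subnK; last exact: ltnW.
    by apply: val_inj; rewrite /= val_iter_ordS modnDr modn_small.
  rewrite cdist_iter modn_small; last by lia.
  exact: ltn_sub2r.
move: (next S s) tS st => t tS st.
have dt : cdist s.1 s.2 < cdist s.1 t.1.
  rewrite ltnNge -mem_positions; apply: contra st => ts.
  by rewrite (represents_inj tS sS (start_positions t) ts).
rewrite shift //; suff lt : cdist s.1 l < cdist s.1 t.1.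
  exact: (ltn_sub2r (leq_ltn_trans dl lt) lt).
(* Otherwise [t] would start strictly closer before [l] than [s] does, against the minimality of
   [m]. *)
rewrite ltnNge; apply/negP => tl.
have tlE : cdist t.1 l = cdist s.1 l - cdist s.1 t.1.
  have {1}-> : l = iter (cdist s.1 l - cdist s.1 t.1) (@ordS n) t.1.
    by rewrite -{2}(iter_cdist s.1 t.1) -iterD subnK // iter_cdist.
  by rewrite cdist_iter modn_small // (leq_ltn_trans (leq_subr _ _)).
have : m <= cdist t.1 l by apply: m_min; apply/hasP; exists t.
by rewrite tlE -sm leqNgt ltn_subrL (leq_trans _ dt) // (leq_trans _ dl).
Qed.

(** The successor of a position of a segment is either in the same segment or the position just
    after its end, whose letter is absent; so letters of different segments are never adjacent. *)
Lemma represents_commute s t x y : s \in S -> t \in S -> s != t ->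
  x \in W -> y \in W -> x \in positions s -> y \in positions t ->
  LC_eq [:: x; y] [:: y; x].
Proof.
have next_neq u v a b : u \in S -> v \in S -> u != v ->
    b \in W -> a \in positions u -> b \in positions v -> b != ordS a.
  move=> uS vS uv bW au bv; apply: contra uv => /eqP bE.
  rewrite bE in bW bv.
  case: (eqVneq a u.2) => [aE|au2].
    by case: (repr_gaps WS uS) => _ _; rewrite -aE bW.
  have au' := positions_ordS (repr_length WS uS) au au2.
  by rewrite (represents_inj uS vS au' bv).
move=> sS tS st xW yW xs yt; apply: LC_commute.
- by apply: contra st => /eqP xy; rewrite (represents_inj sS tS xs) // xy.
- exact: next_neq xs yt.
by apply: next_neq yt xs => //; rewrite eq_sym.
Qed.

Lemma represents_split :
  LC_eq W (flatten [seq [seq x <- W | x \in positions s] | s <- S]).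
Proof.
apply: presented_split (represents_uniq) _ _ _.
- by move=> x /represents_cover[s sS xs]; apply/hasP; exists s.
- move=> s t sS tS st x _ xs.
  by rewrite (disjointFr (represents_disjoint sS tS st) xs).
by move=> s t sS tS st x y xW yW xs yt; apply: represents_commute xs yt.
Qed.

(** Distances from [s.1] turn the restriction of [W] into a line word [w] over [0, ..., d]; its
    normal form is computed on the line and carried back by [line_to_arc]. *)
Lemma represents_segment s : s \in S ->
  LC_eq [seq x <- W | x \in positions s] (segment_word W s).
Proof.
move=> sS; set d := cdist s.1 s.2; set h := fun k => iter k (@ordS n) s.1.
set Ws := filter _ W; set w := [seq cdist s.1 x | x <- Ws].
have hw : Ws = [seq h k | k <- w].
  by rewrite -map_comp map_id_in // => x _; rewrite /= /h iter_cdist.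
have dn : d.+1 < n := repr_length WS sS.
have wd : {in w, forall k, k <= d}.
  move=> k /mapP[x]; rewrite mem_filter => /andP[xs _] ->.
  by rewrite -mem_positions.
have [s1W s2W] := repr_ends WS sS.
have memw k : k <= d -> h k \in W -> k \in w.
  move=> kd kW; have kE : k = cdist s.1 (h k).
    by rewrite cdist_iter modn_small //; apply: leq_ltn_trans kd (ltnW dn).
  rewrite kE map_f // mem_filter kW andbT mem_positions -kE //.
have w0 : 0 \in w by apply: memw.
have wdd : d \in w by apply: memw; rewrite // /h iter_cdist.
have wgap k : k < d -> (k \in w) || (k.+1 \in w).
  move=> kd; case: (boolP (h k \in W)) => hk; first by rewrite memw // ltnW.
  case: (boolP (h k.+1 \in W)) => hk1; first by rewrite (memw k.+1) // orbT.
  case: (repr_inside WS sS (l := h k)) => //.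
  rewrite mem_positions cdist_iter modn_small -/d; first exact: ltnW.
  by apply: ltn_trans kd (ltnW dn).
have toLC v : w ~~~ v -> LC_eq Ws [seq h k | k <- v].
  rewrite hw => wv; apply: (proj2 (line_to_arc s.1 dn wv)).
  by apply/allP => k /wd.
rewrite /segment_word; cbv zeta; rewrite -/d.
case: (ltngtP d 1) => [d1|d2|d1].
- have d0 : d = 0 by move: d1; case: (d).
  rewrite d0 /=; apply: (toLC [:: 0]).
  have w_all0 : all (pred1 0) w by apply/allP => k /wd; rewrite d0 leqn0.
  by case: (w) w0 w_all0 => [|k v] //= _ /andP[/eqP-> /line_single].
- have -> : (d == 0) = false by case: (d) d2.
  have wF := line_full d2 wd w0 wdd wgap.
  case: ifP => od.
    have -> : [seq iter t.*2 (@ordS n) s.1 | t <- iota 0 d./2.+1] =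
        [seq h k | k <- [seq 0 + t.*2 | t <- iota 0 d./2.+1]].
      by rewrite -map_comp.
    apply: toLC; rewrite wF -line_evens.
    by have -> : d./2.*2 = d by rewrite -[RHS]odd_double_half (negbTE od).
  (* For odd [d] the letter 0 is set aside and the interval [1, ..., d], of odd length, is thinned
     out by [line_evens]. *)
  have -> : s.1 :: [seq iter t.*2.+1 (@ordS n) s.1 | t <- iota 0 d./2.+1] =
      [seq h k | k <- 0 :: [seq 1 + t.*2 | t <- iota 0 d./2.+1]].
    by rewrite map_cons -map_comp.
  apply: toLC; rewrite wF -line_evens.
  have -> // : d./2.*2.+1 = d.
  by rewrite -[RHS]odd_double_half; move/negbFE: od => ->.
rewrite d1 /=.
have -> : occurs_before W (ordS s.1) s.1 = subseq [:: 1; 0] w.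
  rewrite occurs_before_subseq.
  have -> : subseq [:: ordS s.1; s.1] W = subseq [:: ordS s.1; s.1] Ws.
    rewrite subseq_filter /= start_positions.
    have -> // : ordS s.1 \in positions s.
    rewrite positions_ordS ?start_positions //; apply/eqP => E.
    by move: d1; rewrite /d -E cdistii.
  apply/idP/idP => [/(map_subseq (cdist s.1)) | /(map_subseq h)].
    by rewrite /= cdist_ordS cdistii //; apply: leq_trans dn; rewrite d1.
  by rewrite -hw.
have := line_pair _ w0 _; rewrite d1 in wd wdd => /(_ wd wdd) /toLC.
by case: ifP.
Qed.

Lemma represents_eq : LC_eq W (flatten (segment_words W S)).
Proof.
apply: presented_trans (represents_split) _; rewrite /segment_words.
(* The induction runs over a sublist, while [represents] keeps speaking of the whole list. *)
have : {subset S <= S} by [].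
elim: {-2}S => [|s S' IH] S'S; first exact: presented_refl.
rewrite /=; apply: cat_presented.
  by apply: represents_segment; apply: S'S; rewrite mem_head.
by apply: IH => t tS'; apply: S'S; rewrite inE tS' orbT.
Qed.

End Represents.
End Arcs.

(** * Invariants of the word *)

Section Invariants.
Variable n : nat.
Implicit Types (i j l p : 'I_n) (u v W : seq 'I_n) (s : segment n).

(** A rotation-invariant form of the relations, without a special case at the wrap-around;
    invariance need only be checked on these five shapes. *)
Variant cyclic_rel : seq 'I_n -> seq 'I_n -> Prop :=
| cyclic_idem i : cyclic_rel [:: i; i] [:: i]
| cyclic_comm i j : i != ordS j -> j != ordS i ->
    cyclic_rel [:: i; j] [:: j; i]
| cyclic_braidl p : cyclic_rel [:: p; ordS p; p] [:: ordS p; p; ordS p]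
| cyclic_braidr p : cyclic_rel [:: ordS p; p; ordS p] [:: ordS p; p]
| cyclic_layer p :
    cyclic_rel [:: p; ordS p; ordS (ordS p)] [:: p; ordS (ordS p)].

Lemma LC_rel_cyclic x y : LC_rel x y -> cyclic_rel x y.
Proof.
have next i j : j = i.+1 :> nat -> j = ordS i.
  move=> ji; apply: val_inj; rewrite /= -ji modn_small //.
have wrap i j : i = 0 :> nat -> j = n.-1 :> nat -> i = ordS j.
  move=> i0 jn; apply: val_inj; rewrite /= jn prednK ?modnn ?i0 //.
  by apply: leq_ltn_trans (ltn_ord j).
case=> {x y} [i | i j ij nij | i j /next-> | i j /next-> |
  i j i0 jn | i j i0 jn | i]; try by constructor.
- have := ltn_ord i; have := ltn_ord j => jn iN.
  apply: cyclic_comm; rewrite -val_eqE.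
    by have /= -> := val_ordS j; case: (j.+1 =P n); lia.
  by have /= -> := val_ordS i; case: (i.+1 =P n); lia.
- by rewrite (wrap _ _ i0 jn); constructor.
by rewrite (wrap _ _ i0 jn); constructor.
Qed.

Definition arc_closure W l : bool :=
  (l \in W) || (ord_pred l \in W) && (ordS l \in W).

Lemma arc_closure_eq W W' : LC_eq W W' -> arc_closure W =1 arc_closure W'.
Proof.
rewrite /LC_eq; elim=> {W W'} [u v x y /LC_rel_cyclic xy | // | x y _ IH l |
  x y z _ IH1 _ IH2 l]; last 2 first.
- by rewrite IH.
- by rewrite IH1.
have content : x =i y -> arc_closure (u ++ x ++ v) =1 arc_closure (u ++ y ++ v).
  by move=> xy' l; rewrite /arc_closure !mem_cat !xy'.
case: xy content => {x y} [i | i j _ _ | p | p | p] content; last first.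
  (* Only the layer relation changes the content. The letter [ordS p] it drops stays in the closure,
     and its neighbours [p] and [ordS (ordS p)] occur on both sides. *)
  move=> l; rewrite /arc_closure !mem_cat !inE.
  case: (eqVneq l p) => [_|lp] /=; first by rewrite !orbT.
  case: (eqVneq l (ordS (ordS p))) => [_|lp2] /=; first by rewrite !orbT.
  have -> : (ord_pred l == ordS p) = false.
    by apply: contra_neqF lp2 => /eqP <-; rewrite ord_predK.
  have -> : (ordS l == ordS p) = false.
    by apply: contra_neqF lp => /eqP /(can_inj (@ordSK n)).
  case: (eqVneq l (ordS p)) => [->|//] /=.
  by rewrite ordSK !eqxx /= !orbT.
- by apply: content => l; rewrite !inE; case: (l == p); case: (l == ordS p).
- by apply: content => l; rewrite !inE; case: (l == p); case: (l == ordS p).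
- by apply: content => l; rewrite !inE orbC.
by apply: content => l; rewrite !inE orbb.
Qed.

(* The letters i and i + 1 commute with every other letter of W, and no
   relation can bring one of the four letters around them into W. *)
Definition isolated_pair W i : bool :=
  [&& ord_pred (ord_pred i) \notin W, ord_pred i \notin W,
      ordS (ordS i) \notin W & ordS (ordS (ordS i)) \notin W].

Lemma subseq2_cat (T : eqType) (a b : T) (s t : seq T) :
  subseq [:: a; b] (s ++ t) =
  [|| subseq [:: a; b] s, (a \in s) && (b \in t) | subseq [:: a; b] t].
Proof.
have sub w : subseq [:: a; b] w -> b \in w.
  by move/mem_subseq; apply; rewrite !inE eqxx orbT.
elim: s => [|c s IH] //=; rewrite inE; case: eqP => _ /=; last exact: IH.
rewrite !sub1seq mem_cat; case: (b \in s) => //=.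
by case: (boolP (b \in t)) => //= /(contraNF (@sub t)) ->.
Qed.

Lemma subseq2_cons (T : eqType) (a b c : T) (s : seq T) :
  subseq [:: a; b] (c :: s) = (a == c) && (b \in s) || subseq [:: a; b] s.
Proof.
rewrite (subseq2_cat a b [:: c] s) /=.
by rewrite inE; case: (a == c).
Qed.

Lemma subseq2_eq W W' i : 2 < n -> LC_eq W W' ->
  isolated_pair W i = isolated_pair W' i /\
  (isolated_pair W i ->
   subseq [:: ordS i; i] W = subseq [:: ordS i; i] W').
Proof.
move=> n3; have S_inj := can_inj (@ordSK n).
have SSneq p : (ordS (ordS p) == p) = false.
  apply/negP => /eqP /(@iter_ordS_inj n p 2 0); lia.
have Sneq p : (ordS p == p) = false.
  apply/negP => /eqP /(@iter_ordS_inj n p 1 0); lia.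
rewrite /LC_eq; elim=> {W W'} [u v x y /LC_rel_cyclic xy | // |
  x y _ [-> IH] | x y z _ [-> IH1] _ [yz IH2]]; last 2 first.
- by split=> // /IH.
- by split=> // yi; rewrite IH1 ?IH2.
have content : x =i y -> subseq [:: ordS i; i] x = subseq [:: ordS i; i] y ->
    isolated_pair (u ++ x ++ v) i = isolated_pair (u ++ y ++ v) i /\
    (isolated_pair (u ++ x ++ v) i ->
     subseq [:: ordS i; i] (u ++ x ++ v) = subseq [:: ordS i; i] (u ++ y ++ v)).
  move=> xy1 xy2; rewrite /isolated_pair !subseq2_cat !mem_cat !xy1 xy2.
  by split.
case: xy content => {x y} [k | k l kl lk | p | p | p] content.
- apply: content => [l|]; first by rewrite !inE orbb.
  rewrite !subseq2_cons !inE !andbF orbF.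
  by case: (eqVneq i k) => [->|]; rewrite ?Sneq ?andbF.
- apply: content => [m|]; first by rewrite !inE orbC.
  rewrite !subseq2_cons !inE !andbF !orbF.
  have -> : (ordS i == k) && (i == l) = false.
    by apply: contraNF kl => /andP[/eqP <- /eqP <-].
  by apply/esym; apply: contraNF lk => /andP[/eqP <- /eqP <-].
- apply: content => [m|].
    by rewrite !inE; case: (m == p); case: (m == ordS p).
  rewrite !subseq2_cons !inE !andbF !orbF (inj_eq S_inj).
  have : (ordS i == p) && (i == ordS p) = false.
    by apply: contraFF (SSneq p) => /andP[/eqP pE /eqP <-]; apply/eqP.
  by case: (i == p); case: (ordS i == p); case: (i == ordS p).
- apply: content => [m|].
    by rewrite !inE; case: (m == p); case: (m == ordS p).
  rewrite !subseq2_cons !inE !andbF !orbF (inj_eq S_inj).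
  have : (ordS i == p) && (i == ordS p) = false.
    by apply: contraFF (SSneq p) => /andP[/eqP pE /eqP <-]; apply/eqP.
  by case: (i == p); case: (ordS i == p); case: (i == ordS p).
set x := [:: p; _; _]; set y := [:: p; _].
have avoid q : q \notin u ++ y ++ v -> (q != p) && (q != ordS (ordS p)).
  by rewrite !mem_cat !inE !negb_or => /and3P[_ /andP[-> ->] _].
have mem_x q : q != ordS p -> (q \in u ++ x ++ v) = (q \in u ++ y ++ v).
  by move=> qp; rewrite !mem_cat !inE (negbTE qp).
have sub_yx q : q \notin u ++ x ++ v -> q \notin u ++ y ++ v.
  by apply: contra; rewrite !mem_cat !inE => /or3P[|/orP[]|] ->; rewrite ?orbT.
(* Each of the four excluded letters has a neighbour among the four, whereas both neighbours of the
   inserted [ordS p] occur; so [ordS p] is none of them. *)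
have iso_xy : isolated_pair (u ++ x ++ v) i = isolated_pair (u ++ y ++ v) i.
  apply/idP/idP => /and4P[q1 q2 q3 q4]; apply/and4P; split; rewrite ?sub_yx //.
  - rewrite mem_x //; apply: contraTneq (avoid _ q2) => /(congr1 (@ordS n)).
    by rewrite ord_predK => ->; rewrite eqxx andbF.
  - rewrite mem_x //; apply: contraTneq (avoid _ q1) => ->.
    by rewrite ordSK eqxx.
  - rewrite mem_x //; apply: contraTneq (avoid _ q4) => ->.
    by rewrite eqxx andbF.
  rewrite mem_x //; apply: contraTneq (avoid _ q3) => /S_inj ->.
  by rewrite eqxx.
rewrite iso_xy; split=> // /and4P[_ /avoid q2 /avoid q3 _].
(* Nor is [ordS p] a letter of the pair: [i] has an absent predecessor and [ordS i] an absent
   successor. *)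
have ip : (i == ordS p) = false.
  by apply: contraTF q2 => /eqP ->; rewrite ordSK eqxx.
have ip' : (i == p) = false.
  by apply: contraTF q3 => /eqP ->; rewrite eqxx andbF.
rewrite !subseq2_cat !subseq2_cons !mem_cat !inE !(inj_eq S_inj).
by rewrite ip ip' !andbF.
Qed.

(** A maximal arc of the closure. It depends on [W] only through [arc_closure], so it is an
    invariant of the class of [W]. *)
Definition is_run W s : bool :=
  [&& all (arc_closure W) (positions s), ~~ arc_closure W (ord_pred s.1)
    & ~~ arc_closure W (ordS s.2)].

Lemma represents_run W (S : seq (segment n)) s : represents W S -> s \in S ->
  is_run W s.
Proof.
move=> WS sS; have [s1W s2W] := repr_ends WS sS.
have [g1 g2 g3 g4] := repr_gaps WS sS; apply/and3P; split; last 2 first.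
- by rewrite /arc_closure (negbTE g1) (negbTE g2).
- by rewrite /arc_closure (negbTE g3) (negbTE g4) andbF.
apply/allP => l ls; rewrite /arc_closure; case: (boolP (l \in W)) => //= lW.
have -> : ordS l \in W.
  by apply/negPn/negP => nSl; apply: (repr_inside WS sS ls).
rewrite andbT; apply/negPn/negP => npl.
apply: (repr_inside WS sS (l := ord_pred l)); last by rewrite ord_predK.
by apply: positions_ord_pred => //; apply: contraNneq lW => ->.
Qed.

(** The first letter of the run occurs in [W], hence lies in some segment [t]. Both arcs are maximal
    in the closure, so they have the same start and then the same end. *)
Lemma run_represents W (S : seq (segment n)) s : represents W S ->
  (cdist s.1 s.2).+1 < n -> is_run W s -> s \in S.
Proof.
move=> WS sn /and3P[/allP s_run s_pred s_succ].
have s1W : s.1 \in W.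
  have := s_run _ (start_positions s); rewrite /arc_closure.
  case/orP=> // /andP[ps1 _]; by rewrite /arc_closure ps1 in s_pred.
have [t tS ts1] := represents_cover WS s1W.
have tn := repr_length WS tS.
have /and3P[/allP t_run t_pred t_succ] := represents_run WS tS.
have st1 : s.1 = t.1.
  apply/eqP; apply: contraNT s_pred => st1.
  by apply: t_run; apply: positions_ord_pred.
suff dE : cdist s.1 s.2 = cdist t.1 t.2.
  suff st2 : s.2 = t.2 by case: (s) (t) st1 st2 tS => [? ?] [? ?] /= -> ->.
  by rewrite -(iter_cdist s.1 s.2) dE st1 iter_cdist.
move: sn; rewrite st1 => sn.
case: (ltngtP (cdist t.1 s.2) (cdist t.1 t.2)) => // d_lt.
  by case/negP: s_succ; apply: t_run; rewrite mem_positions cdist_ordS.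
by case/negP: t_succ; apply: s_run; rewrite mem_positions st1 cdist_ordS.
Qed.

Lemma represents_unique W W' (S S' : seq (segment n)) : LC_eq W W' ->
  represents W S -> represents W' S' -> perm_eq S S'.
Proof.
move=> WW' WS WS'.
have runE s : is_run W s = is_run W' s.
  by rewrite /is_run !(arc_closure_eq WW') (eq_all (arc_closure_eq WW')).
apply: uniq_perm (represents_uniq WS) (represents_uniq WS') _ => s.
apply/idP/idP => sS.
  apply: (run_represents WS' (repr_length WS sS)).
  by rewrite -runE (represents_run WS sS).
apply: (run_represents WS (repr_length WS' sS)).
by rewrite runE (represents_run WS' sS).
Qed.

Lemma segment_words_unique W W' (S S' : seq (segment n)) : LC_eq W W' ->
  represents W S -> represents W' S' ->
  perm_eq (segment_words W S) (segment_words W' S').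
Proof.
move=> WW' WS WS'.
(* For a fixed segment the word depends on [W] only when the segment has two positions, through the
   order of two letters forming an isolated pair. *)
suff -> : segment_words W S = segment_words W' S.
  exact: perm_map (represents_unique WW' WS WS').
apply/eq_in_map => s sS; rewrite /segment_word; cbv zeta.
case: (eqVneq (cdist s.1 s.2) 1) => // d1.
suff -> : occurs_before W (ordS s.1) s.1 =
    occurs_before W' (ordS s.1) s.1 by [].
rewrite !occurs_before_subseq.
have n3 : 2 < n by have := repr_length WS sS; rewrite d1.
apply: (proj2 (subseq2_eq s.1 n3 WW')).
have [g1 g2] := repr_gaps WS sS.
have <- : ordS s.1 = s.2 by rewrite -[RHS](iter_cdist s.1) d1.
by move=> g3 g4; apply/and4P.
Qed.

End Invariants.

(** * Existence of the segments *)

Section Runs.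
Variables (n : nat) (q : pred nat).
Hypotheses (q0 : ~~ q 0) (q1 : ~~ q 1).

(** The truncated predecessors matter only for [k] equal to 0 or 1, where [q] is false. *)
Definition run_start k : bool := [&& q k, ~~ q k.-1 & ~~ q k.-2].
Definition run_stop k : bool := [&& q k, ~~ q k.+1 & ~~ q k.+2].
Definition run_end k : nat := find (fun j => (k <= j) && run_stop j) (iota 0 n).
Definition run_starts : seq nat := filter run_start (iota 0 n).

(** Walk back from [m] by one or two positions as long as an occupied one is found. *)
Lemma run_start_ex m : q m -> exists k, [/\ run_start k, k <= m &
  forall j, k <= j < m -> q j || q j.+1].
Proof.
have [M mM] := ubnP m; elim: M m mM => // M IH m mM qm.
case: (boolP (q m.-1)) => qm1.
  have m0 : 0 < m by case: m qm {mM qm1} => //; rewrite (negbTE q0).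
  have [|k [kS km kq]] := IH m.-1 _ qm1; first by lia.
  exists k; split=> //; first by lia.
  move=> j jm; case: (eqVneq j m.-1) => [->|jm1]; first by rewrite qm1.
  by apply: kq; lia.
case: (boolP (q m.-2)) => qm2.
  have m1 : 1 < m.
    by case: m qm {mM qm1 qm2} => [|[|]] //; rewrite (negbTE q0, negbTE q1).
  have [|k [kS km kq]] := IH m.-2 _ qm2; first by lia.
  exists k; split=> //; first by lia.
  move=> j jm; case: (eqVneq j m.-2) => [->|jm2]; first by rewrite qm2.
  case: (eqVneq j m.-1) => [->|jm1]; first by rewrite prednK ?qm ?orbT // ltnW.
  by apply: kq; lia.
exists m; split=> //; first by rewrite /run_start qm qm1 qm2.
by move=> j; lia.
Qed.

Hypotheses (qn : ~~ q n) (qn1 : ~~ q n.+1).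

Lemma run_stop_ex m : m < n -> q m -> exists2 j, m <= j < n & run_stop j.
Proof.
have [M mM] := ubnP (n - m); elim: M m mM => // M IH m mM mn qm.
case: (boolP (q m.+1)) => qm1.
  have mn1 : m.+1 < n.
    by rewrite ltn_neqAle mn andbT; apply: contraTneq qm1 => ->.
  have [|j jm js] := IH m.+1 _ mn1 qm1; first by lia.
  by exists j => //; lia.
case: (boolP (q m.+2)) => qm2.
  have mn2 : m.+2 < n.
    have : m.+2 != n by apply: contraTneq qm2 => ->.
    have : m.+2 != n.+1 by apply: contraTneq qm2 => ->.
    by lia.
  have [|j jm js] := IH m.+2 _ mn2 qm2; first by lia.
  by exists j => //; lia.
by exists m; rewrite ?leqnn ?mn // /run_stop qm qm1 qm2.
Qed.

Lemma run_startsE k : (k \in run_starts) = run_start k && (k < n).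
Proof. by rewrite mem_filter mem_iota. Qed.

Section Run.
Variable k : nat.
Hypothesis kS : k \in run_starts.

Lemma run_endP : [/\ k <= run_end k, run_end k < n & run_stop (run_end k)].
Proof.
have /andP[/and3P[qk _ _] kn] : run_start k && (k < n) by rewrite -run_startsE.
have [j /andP[kj jn] js] := run_stop_ex kn qk.
have hasj : has (fun j => (k <= j) && run_stop j) (iota 0 n).
  by apply/hasP; exists j; rewrite ?mem_iota ?kj.
have en : run_end k < n by move: hasj; rewrite has_find size_iota.
by have := nth_find 0 hasj; rewrite nth_iota // add0n => /andP[].
Qed.

Lemma run_inside l : k <= l < run_end k -> q l || q l.+1.
Proof.
have /andP[/and3P[qk _ _] kn] : run_start k && (k < n) by rewrite -run_startsE.
elim: l => [|l IH] /andP[kl le].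
  by move: kl; rewrite leqn0 => /eqP k0; rewrite -k0 qk.
case: (eqVneq k l.+1) => [<-|kl1]; first by rewrite qk.
have kl' : k <= l by lia.
have := IH; rewrite kl' (ltnW le) => /(_ isT).
case: (boolP (q l.+1)) => //= ql1; rewrite orbF => ql.
(* Two empty positions after [l] would make [l] a stop before [run_end k], which is the first
   one. *)
apply/negPn/negP => ql2.
have ln : l < n by case: run_endP => _ en _; lia.
have := @before_find _ 0 (fun j => (k <= j) && run_stop j) (iota 0 n) l.
move/(_ (ltnW le)).
by rewrite nth_iota // add0n kl' /run_stop ql ql1 ql2.
Qed.

Lemma run_start_after m : run_end k < m < n -> q m ->
  exists2 u, u \in run_starts & run_end k < u <= m.
Proof.
move=> /andP[em mn] qm; have [_ _ /and3P[_ e1 e2]] := run_endP.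
have [u [uS um uq]] := run_start_ex qm; exists u.
  by rewrite run_startsE uS (leq_ltn_trans um).
rewrite um andbT ltnNge; apply/negP => ue.
have em1 : m != (run_end k).+1 by apply: contraTneq qm => ->.
have := uq (run_end k).+1; rewrite (negbTE e1) (negbTE e2) => uq'.
by have : false by apply: uq'; lia.
Qed.

End Run.

(** Otherwise the two empty positions preceding [k'] would lie inside the run starting at [k]. *)
Lemma run_end_lt k k' : k \in run_starts -> k' \in run_starts -> k < k' ->
  run_end k < k'.
Proof.
move=> kS k'S kk'; rewrite ltnNge; apply/negP => ek'.
move: k'S (kS); rewrite !run_startsE => /andP[/and3P[_ qk1 qk2] _].
move=> /andP[/and3P[qk _ _] _].
have kk1 : k != k'.-1 by apply: contraNneq qk1 => <-.
have : q k'.-2 || q k'.-2.+1 by apply: (run_inside kS); lia.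
by rewrite prednK ?(negbTE qk1) ?(negbTE qk2) //; lia.
Qed.

Lemma sorted_run_starts : sorted ltn run_starts.
Proof. exact: (sorted_filter ltn_trans) (iota_ltn_sorted 0 n). Qed.

End Runs.

(** * Construction of the segments from the two-letter gap *)

Section Existence.
Variables (n : nat) (W : seq 'I_n) (r : 'I_n).
Hypotheses (W_neq0 : W <> [::]) (r1W : ordS r \notin W)
  (r2W : ordS (ordS r) \notin W).

(** The circle is cut open at the gap: counting starts at [ordS r], so positions 0 and 1, and by
    periodicity [n] and [n.+1], are empty and no run crosses the cut. *)
Let pos k : 'I_n := iter k (@ordS n) (ordS r).
Let occ : pred nat := fun k => pos k \in W.
Let arc k : segment n := (pos k, pos (run_end n occ k)).
Let starts := run_starts n occ.

Lemma pos_periodic k : pos (n + k) = pos k.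
Proof.
apply: val_inj; rewrite /pos [LHS]val_iter_ordS [RHS]val_iter_ordS.
by rewrite addnCA modnDl.
Qed.

(** The value [k = n] is allowed because the position after the end of a run can be [n]. *)
Lemma cdist_pos k m : k <= n -> m < n ->
  cdist (pos k) (pos m) = if k <= m then m - k else n + m - k.
Proof.
move=> kn mn; case: leqP => km.
  rewrite -(subnK km) /pos iterD cdist_iter addnK modn_small //.
  exact: leq_ltn_trans (leq_subr _ _) mn.
rewrite -(pos_periodic m) -{1}(@subnK k (n + m)); last by lia.
by rewrite /pos iterD cdist_iter modn_small //; lia.
Qed.

Lemma ord_pred_pos k : 0 < k -> ord_pred (pos k) = pos k.-1.
Proof. by case: k => // k _; rewrite /pos iterS ordSK. Qed.

Lemma pos_cdist l : pos (cdist (ordS r) l) = l.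
Proof. exact: iter_cdist. Qed.

Lemma occ0 : ~~ occ 0. Proof. exact: r1W. Qed.
Lemma occ1 : ~~ occ 1. Proof. exact: r2W. Qed.
Lemma occn : ~~ occ n.
Proof. by have := pos_periodic 0; rewrite addn0 /occ => ->; exact: occ0. Qed.
Lemma occn1 : ~~ occ n.+1.
Proof. by have := pos_periodic 1; rewrite addn1 /occ => ->; exact: occ1. Qed.

Lemma starts_gt1 k : run_start occ k -> 1 < k.
Proof.
case/and3P=> qk _ _; case: k qk => [|[|k]] //.
  by rewrite (negbTE occ0).
by rewrite (negbTE occ1).
Qed.

Lemma run_endE k : k \in starts ->
  [/\ k <= run_end n occ k, run_end n occ k < n &
      run_stop occ (run_end n occ k)].
Proof. by move=> kS; exact: (run_endP occ0 occ1 occn occn1 kS). Qed.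

Lemma mem_arc k m : k \in starts -> m < n ->
  (pos m \in positions (arc k)) = (k <= m <= run_end n occ k).
Proof.
move=> kS mn; have [ke en _] := run_endE kS.
rewrite mem_positions /= !cdist_pos ?ke //; try by lia.
by case: (leqP k m) => km; lia.
Qed.

Lemma run_of m : m < n -> occ m -> exists2 k, k \in starts &
  k <= m <= run_end n occ k.
Proof.
move=> mn qm; have [k [kS km kq]] := run_start_ex occ0 occ1 qm.
have kS' : k \in starts by rewrite run_startsE kS (leq_ltn_trans km).
exists k => //; rewrite km leqNgt /=; apply/negP => em.
have [ke _ /and3P[qe qe1 qe2]] := run_endE kS'.
have em1 : m != (run_end n occ k).+1 by apply: contraTneq qm => ->.
have : occ (run_end n occ k).+1 || occ (run_end n occ k).+2 by apply: kq; lia.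
by rewrite (negbTE qe1) (negbTE qe2).
Qed.

Lemma starts_neq0 : starts <> [::].
Proof.
case WE: W W_neq0 => [|x W'] // _ starts0.
have qx : occ (cdist (ordS r) x) by rewrite /occ pos_cdist WE mem_head.
by have [k] := run_of (cdist_lt _ _) qx; rewrite starts0.
Qed.

Lemma next_arc k0 ks s : starts = k0 :: ks -> s \in map arc starts ->
  exists k k', [/\ k \in starts, k' \in starts, s = arc k,
    next (map arc starts) s = arc k' &
    {in starts, forall u, k < u -> k < k' <= u} /\ (k < k' \/ k' = k0)].
Proof.
move=> startsE sS; set idx := index s (map arc starts).
have idx_lt : idx < size starts by rewrite -(size_map arc) index_mem.
have s_sorted : sorted ltn starts := sorted_run_starts n occ.
(* The default [k0] of the second [nth] encodes the wrap-around: the last start is followed by the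
   first. *)
exists (nth k0 starts idx), (nth k0 ks idx); split.
- exact: mem_nth.
- rewrite startsE; case: (ltnP idx (size ks)) => idx_ks.
    by rewrite inE mem_nth ?orbT.
  by rewrite nth_default // mem_head.
- by rewrite -(nth_map _ (arc k0)) // nth_index.
- rewrite next_nth sS -/idx startsE /=.
  case: (ltnP idx (size ks)) => idx_ks; first by rewrite (nth_map k0).
  by rewrite !nth_default // size_map.
have nextE : nth k0 ks idx = nth k0 starts idx.+1 by rewrite startsE.
have nth_lt i j : i < j -> j < size starts -> nth k0 starts i < nth k0 starts j.
  move=> ij jS; apply: (sorted_ltn_nth ltn_trans k0 s_sorted) => //.
  exact: ltn_trans ij jS.
split=> [u uS|].
  rewrite -(nth_index k0 uS) nextE => ku.
  have uS' : index u starts < size starts by rewrite index_mem.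
  have iu : idx < index u starts.
    rewrite ltnNge; apply/negP; rewrite leq_eqVlt => /orP[/eqP E|ui].
      by rewrite E ltnn in ku.
    by rewrite ltnNge (ltnW (nth_lt _ _ ui idx_lt)) in ku.
  rewrite nth_lt ?(leq_ltn_trans iu) //=.
  by move: iu; rewrite leq_eqVlt => /orP[/eqP->|/nth_lt/(_ uS')/ltnW].
rewrite nextE; case: (ltnP idx.+1 (size starts)) => idx_ks.
  by left; apply: nth_lt.
by right; rewrite nth_default.
Qed.

Lemma represents_arcs : represents W (map arc starts).
Proof.
have n_gt0 : 0 < n by apply: leq_ltn_trans (ltn_ord r).
have W_pos l : (l \in W) = occ (cdist (ordS r) l) by rewrite /occ pos_cdist.
have startsE' k : k \in starts -> run_start occ k && (k < n).
  by rewrite run_startsE.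
split.
- by case: starts starts_neq0.
- move=> _ /mapP[k kS ->] /=; have [ke en _] := run_endE kS.
  have /andP[/starts_gt1 k_gt1 kn] := startsE' k kS.
  by rewrite cdist_pos ?ke; lia.
- rewrite pairwise_map; have := sorted_run_starts n occ.
  rewrite -/starts (sorted_pairwise ltn_trans).
  apply: sub_in_pairwise (allss starts) => k k' kS k'S kk'.
  suff : [disjoint positions (arc k) & positions (arc k')] by [].
  have ek' := run_end_lt occ0 occ1 occn occn1 kS k'S kk'.
  rewrite disjoint_has; apply/hasPn => l.
  rewrite -(pos_cdist l) !mem_arc ?cdist_lt // => lk.
  by apply/negP; lia.
- have := sorted_run_starts n occ; rewrite -/starts.
  case startsE: starts => [|k0 ks] // k0ks.
  rewrite -[clockwise _]/(sorted ltn
    [seq cdist (pos k0) s.1 | s <- map arc (k0 :: ks)]) -map_comp.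
  apply: (homo_sorted_in (P := fun k => k0 <= k < n) _ _ k0ks).
    move=> k k' /andP[k0k kn] /andP[k0k' k'n] kk' /=.
    by rewrite !cdist_pos // ?k0k ?k0k' ?ltn_sub2r //; lia.
  apply/allP => k kS; have /andP[_ ->] : run_start occ k && (k < n).
    by apply: startsE'; rewrite startsE.
  rewrite andbT; move: kS; rewrite inE => /orP[/eqP-> //|].
  by move/(allP (order_path_min ltn_trans k0ks))/ltnW.
- exists (pos 0) => _ /mapP[k kS ->]; rewrite mem_arc //.
  by have /andP[/starts_gt1 k_gt1 _] := startsE' k kS; case: k {kS} k_gt1.
- move=> _ /mapP[k kS ->]; have [_ _ /and3P[qe _ _]] := run_endE kS.
  by have /andP[/and3P[qk _ _] _] := startsE' k kS.
- move=> _ /mapP[k kS ->]; have [_ _ /and3P[_ qe1 qe2]] := run_endE kS.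
  have /andP[kst _] := startsE' k kS; have := starts_gt1 kst.
  case/and3P: kst => _ qk1 qk2 k_gt1; split=> //=.
    by rewrite !ord_pred_pos //; lia.
  by rewrite ord_pred_pos //; lia.
- move=> _ /mapP[k kS ->] l; rewrite -(pos_cdist l) mem_arc ?cdist_lt //.
  set m := cdist _ l => /andP[km me] [qm qm1].
  have [_ _ /and3P[qe _ _]] := run_endE kS.
  have me' : m != run_end n occ k by apply: contraNneq qm => ->.
  have : occ m || occ m.+1 by apply: (run_inside occ0 occ1 occn occn1 kS); lia.
  by case/orP; apply/negP; [exact: qm | exact: qm1].
move=> s sS l.
have [k0 [ks startsE]] : exists k0 ks, starts = k0 :: ks.
  by case: starts starts_neq0 => // k0 ks _; exists k0, ks.
have [k [k' [kS k'S -> -> [k'_min k'_next]]]] := next_arc startsE sS.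
have [ke en _] := run_endE kS; have [_ k'n] := andP (startsE' _ k'S).
rewrite /between /= -!(iterS _ (@ordS n)) -(pos_cdist l).
have mn := cdist_lt (ordS r) l; set m := cdist _ l in mn *.
rewrite -/(pos (run_end n occ k).+1) !cdist_pos //.
move=> btw; apply/negP => qm.
have k'_far : k < k' -> run_end n occ k < k'.
  exact: (run_end_lt occ0 occ1 occn occn1).
(* An occupied [m] after the run belongs to a later run, whose start is at least [k'], so [m] is not
   before [k']. *)
case: (ltnP (run_end n occ k) m) => em.
  have [u uS /andP[eu um]] : exists2 u, u \in starts & run_end n occ k < u <= m.
    by apply: (run_start_after occ0 occ1 occn occn1 kS); rewrite ?em.
  have /andP[kk' k'u] := k'_min u uS (leq_ltn_trans ke eu).
  move: btw; rewrite em (k'_far kk') ltnNge leq_sub2r //.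
  exact: leq_trans k'u um.
(* If [m] is not after the run, it is reached only beyond the cut. The next start is then either met
   before the cut or equal to [k0], which is at most [m]. *)
have k0m : k0 <= m.
  have [u uS /andP[um _]] := run_of mn qm; apply: leq_trans um.
  have := sorted_run_starts n occ; rewrite -/starts startsE /= => k0ks.
  move: uS; rewrite startsE inE => /orP[/eqP-> //|].
  by move/(allP (order_path_min ltn_trans k0ks))/ltnW.
move: btw; rewrite (ltnNge _ m) em /=.
case: (ltnP (run_end n occ k) k') => [_ | ek']; first by lia.
case: k'_next => [/k'_far|->]; first by rewrite ltnNge ek'.
by rewrite ltnNge leq_sub2r // leq_add2l.
Qed.

End Existence.

Theorem proposition3p2 (n : nat) (n_ge1 : 1 <= n) :
  (forall W : seq 'I_n, W <> [::] -> two_gap W ->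
     (exists S : seq (segment n), represents W S) /\
     (forall S : seq (segment n), represents W S ->
        LC_eq W (flatten (segment_words W S)))) /\
  (forall (W W' : seq 'I_n) (S S' : seq (segment n)),
     W <> [::] -> two_gap W -> represents W S ->
     W' <> [::] -> two_gap W' -> represents W' S' ->
     LC_eq W W' ->
     perm_eq (segment_words W S) (segment_words W' S')).
Proof.
split=> [W W_neq0 [r [r1W r2W]] | W W' S S' _ _ WS _ _ WS' WW'].
  split; last by move=> S; apply: represents_eq.
  by eexists; apply: represents_arcs W_neq0 r1W r2W.
exact: segment_words_unique.
Qed.
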